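(* Let $\lambda_*\in\mathbb{R}$ be a simple eigenvalue of a self-adjoint discrete Sturm-Liouville problem $(\boldsymbol{\omega},\mathbf{A})\in\Omega_N^{\mathbb{R},+}\times\mathcal{B}^{\mathbb{C}}$. Then the continuous simple eigenvalue branch $\Lambda$ defined on a neighborhood of $(\boldsymbol{\omega},\mathbf{A})$ in $\Omega_N^{\mathbb{R},+}\times\mathcal{B}^{\mathbb{C}}$ through $\lambda_*$ is a $C^\infty$ function.
   Context: $N\ge2$ is an integer, $\Delta y_n=y_{n+1}-y_n$, $\nabla y_n=y_n-y_{n-1}$. A discrete Sturm-Liouville equation $-\nabla(f_n\Delta y_n)+q_ny_n=\lambda w_ny_n$, $1\le n\le N$, is identified with $\boldsymbol{\omega}=(1/f,q,w)=(1/f_0,\dots,1/f_N,q_1,\dots,q_N,w_1,\dots,w_N)$; $\Omega_N^{\mathbb{R},+}$ is the open subset of $\mathbb{R}^{3N+1}$ of real triples with $f_n\ne0$ ($0\le n\le N$) and $w_n>0$ ($1\le n\le N$). A boundary condition is $A\begin{pmatrix}y_0\\ f_0\Delta y_0\end{pmatrix}+B\begin{pmatrix}y_N\\ f_N\Delta y_N\end{pmatrix}=0$ with $A,B$ complex $2\times2$ matrices, $\mathrm{rank}(A,B)=2$; it is denoted $\mathbf{A}=[A\,|\,B]$, where $(A,B)$ and $(TA,TB)$, $T\in GL(2,\mathbb{C})$, are identified. The set of boundary conditions has the quotient topology, and $\mathcal{B}^{\mathbb{C}}$ is its subspace of self-adjoint boundary conditions, i.e. those with $AEA^*=BEB^*$,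 $E=\begin{pmatrix}0&1\\-1&0\end{pmatrix}$. $\mathcal{B}^{\mathbb{C}}$ is a real-analytic manifold of dimension 4 with the four charts (coordinates: the two real parameters and the real and imaginary parts of $z\in\mathbb{C}$) $$\mathcal{O}_{1,3}^{\mathbb{C}}=\left\{\left[\begin{array}{cccc}1&a_{12}&0&\bar z\\0&z&-1&b_{22}\end{array}\right]\right\},\quad \mathcal{O}_{1,4}^{\mathbb{C}}=\left\{\left[\begin{array}{cccc}1&a_{12}&\bar z&0\\0&z&b_{21}&1\end{array}\right]\right\},$$ $$\mathcal{O}_{2,3}^{\mathbb{C}}=\left\{\left[\begin{array}{cccc}a_{11}&-1&0&\bar z\\ z&0&-1&b_{22}\end{array}\right]\right\},\quad \mathcal{O}_{2,4}^{\mathbb{C}}=\left\{\left[\begin{array}{cccc}a_{11}&-1&\bar z&0\\ z&0&b_{21}&1\end{array}\right]\right\},$$ which are relatively open and cover $\mathcal{B}^{\mathbb{C}}$. A complex number $\lambda$ is an eigenvalue of the problem if there is a nonzero sequence $y=\{y_n\}_{n=0}^{N+1}$ of complex numbers satisfying both the equation and the boundary condition; for self-adjoint problems all eigenvalues are real. $\phi(\lambda),\psi(\lambda)$ are the solutions of the equation with $\phi_0=1$, $f_0\Delta\phi_0=0$, $\psi_0=0$, $f_0\Delta\psi_0=1$, and $\Phi_N(\lambda)=\begin{pmatrix}\phi_N(\lambda)&\psi_N(\lambda)\\ f_N\Delta\phi_N(\lambda)&f_N\Delta\psi_N(\lambda)\end{pmatrix}$. An eigenvalue is simple if it is a zero of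 order $1$ of the polynomial $\Gamma(\lambda)=\det(A+B\Phi_N(\lambda))$. The continuous simple eigenvalue branch over $\Omega_N^{\mathbb{R},+}\times\mathcal{B}^{\mathbb{C}}$ through $\lambda_*$: a continuous real-valued function $\Lambda$ on a connected neighborhood of $(\boldsymbol{\omega},\mathbf{A})$ in $\Omega_N^{\mathbb{R},+}\times\mathcal{B}^{\mathbb{C}}$ with $\Lambda(\boldsymbol{\omega},\mathbf{A})=\lambda_*$ such that $\Lambda(\boldsymbol{\sigma},\mathbf{B})$ is a simple eigenvalue of $(\boldsymbol{\sigma},\mathbf{B})$ for every $(\boldsymbol{\sigma},\mathbf{B})$ in that neighborhood (it exists and is locally unique). *)

(* Defs.v *)
From HB Require Import structures.
From mathcomp Require Import all_boot all_order all_algebra complex.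
From mathcomp Require Import all_classical all_reals all_analysis.

Set Implicit Arguments.
Unset Strict Implicit.
Unset Printing Implicit Defensive.

Import Order.TTheory GRing.Theory Num.Theory.
Import numFieldNormedType.Exports.

Local Open Scope classical_set_scope.
Local Open Scope quotient_scope.
Local Open Scope ring_scope.
Local Open Scope complex_scope.

(* R[i] with the topology of the modulus *)
#[export, non_forgetful_inheritance]
HB.instance Definition _ (R : rcfType) := PseudoPointedMetric.copy R[i] R[i]^o.

(* The point (1/f, q, w) of R^(3N+1). The first row lists 1/f_0 .. 1/f_N; the
   other two are q_1 .. q_N and w_1 .. w_N, i.e. shifted by one. *)
Notation sl_coef R N := ('rV[R]_N.+1 * 'rV[R]_N * 'rV[R]_N)%type.

(* the two real parameters of a chart, then Re z and Im z *)
Notation chart_coord R := (R * R * (R * R))%type.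

Section DiscreteSturmLiouville.
Variables (R : realType) (N : nat).

Definition row_nth m (v : 'rV[R]_m) (n : nat) : R :=
  if insub n is Some i then v 0 i else 0.

Implicit Type om : sl_coef R N.

Definition sl_f om n : R := (row_nth om.1.1 n)^-1.
Definition sl_q om n : R := row_nth om.1.2 n.-1.
Definition sl_w om n : R := row_nth om.2 n.-1.

Definition Omega : set (sl_coef R N) :=
  [set om : sl_coef R N | (forall i, om.1.1 0 i != 0) /\ (forall i, 0 < om.2 0 i)].

Definition delta (V : zmodType) (y : nat -> V) n : V := y n.+1 - y n.
Definition nabla (V : zmodType) (y : nat -> V) n : V := y n - y n.-1.

(* y_n is only relevant for n <= N+1 *)
Definition sl_equation om (lam : R[i]) (y : nat -> R[i]) : Prop :=
  forall n, (0 < n <= N)%N ->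
    - nabla (fun k => (sl_f om k)%:C * delta y k) n + (sl_q om n)%:C * y n
      = lam * (sl_w om n)%:C * y n.

(* Pair (y_n, f_n Delta y_n), as polynomials in the spectral parameter, for the
   solution with y_0 = c and f_0 Delta y_0 = d. *)
Fixpoint sl_ivp om (c d : R[i]) n : {poly R[i]} * {poly R[i]} :=
  if n is m.+1 then
    let yu := sl_ivp om c d m in
    let y := yu.1 + ((sl_f om m)^-1)%:C *: yu.2 in
    (y, yu.2 + ((sl_q om n)%:C%:P - (sl_w om n)%:C *: 'X) * y)
  else (c%:P, d%:P).

Definition phi om n : {poly R[i]} := (sl_ivp om 1 0 n).1.
Definition psi om n : {poly R[i]} := (sl_ivp om 0 1 n).1.

Lemma sl_ivp_delta om c d n : om \in Omega -> (n <= N)%N ->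
  (sl_f om n)%:C *: delta (fun k => (sl_ivp om c d k).1) n = (sl_ivp om c d n).2.
Proof.
rewrite inE => -[f0 _] nN; rewrite /delta /= addrAC subrr add0r scalerA -rmorphM.
rewrite divff ?scale1r// invr_eq0 /row_nth insubT ?ltnS//; exact: f0.
Qed.

Lemma sl_ivp2_horner om c d n (lam : R[i]) :
  (sl_ivp om c d n.+1).2.[lam] = (sl_ivp om c d n).2.[lam] +
    ((sl_q om n.+1)%:C - (sl_w om n.+1)%:C * lam) * (sl_ivp om c d n.+1).1.[lam].
Proof.
have E (u y : {poly R[i]}) (a b : R[i]) : (u + (a%:P - b *: 'X) * y).[lam] =
    u.[lam] + (a - b * lam) * y.[lam] by rewrite !hornerE.
exact: E.
Qed.

Lemma sl_ivp_equation om c d (lam : R[i]) : om \in Omega ->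
  sl_equation om lam (fun n => (sl_ivp om c d n).1.[lam]).
Proof.
move=> oO [//|n] /andP[_ nN].
have E k : (k <= N)%N ->
    (sl_f om k)%:C * delta (fun n => (sl_ivp om c d n).1.[lam]) k
    = (sl_ivp om c d k).2.[lam].
  by move=> kN; rewrite -sl_ivp_delta// hornerZ; congr (_ * _);
    rewrite /delta [RHS]hornerD hornerN.
rewrite /nabla [n.+1.-1]/= !E//; last exact: ltnW.
rewrite sl_ivp2_horner mulrBl.
set x := (sl_ivp _ _ _ n).2.[_]; set y := (sl_ivp _ _ _ _).1.[_].
rewrite (addrC x) addrK opprB addrNK; congr (_ * _); exact: mulrC.
Qed.

Lemma sl_ivp_unique om (lam : R[i]) (y : nat -> R[i]) n : om \in Omega ->
  sl_equation om lam y -> (n <= N.+1)%N ->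
  y n = (sl_ivp om (y 0) ((sl_f om 0)%:C * delta y 0) n).1.[lam].
Proof.
move=> oO ey; set p := sl_ivp om _ _.
have f0 k : (k <= N)%N -> sl_f om k != 0.
  move: oO; rewrite inE => -[f0 _] kN.
  by rewrite invr_eq0 /row_nth insubT ?ltnS//; exact: f0.
have yS k : (k <= N)%N ->
    y k.+1 = y k + ((sl_f om k)^-1)%:C * ((sl_f om k)%:C * delta y k).
  by move=> kN; rewrite mulrA -rmorphM mulVf ?f0// mul1r addrC subrK.
suff H k : (k <= N)%N ->
    y k = (p k).1.[lam] /\ (sl_f om k)%:C * delta y k = (p k).2.[lam].
  case: n => [_|n nN]; first by rewrite /p /= hornerC.
  by have [e1 e2] := H n nN; rewrite yS// e2 e1 /= hornerD hornerZ.
elim: k => [_|k IH kN]; first by rewrite /p /= !hornerC.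
have [e1 e2] := IH (ltnW kN).
have e : y k.+1 = (p k.+1).1.[lam].
  by rewrite yS 1?ltnW// e2 e1 /= hornerD hornerZ.
split=> //; have := ey k.+1; rewrite kN => /(_ isT).
rewrite /nabla [k.+1.-1]/= e2 e.
rewrite [(p k.+1).2.[lam]]sl_ivp2_horner -/p mulrBl.
rewrite [X in _ = _ + (_ - X * _)]mulrC => <-.
set D := (sl_f om k.+1)%:C * _; set Q := (sl_q om _)%:C * _.
by rewrite opprD opprK (addrC (D - _)) addNKr addrC subrK.
Qed.

Definition mx22 (V : nmodType) (a b c d : V) : 'M[V]_2 :=
  \matrix_(i < 2, j < 2) nth 0 (nth [::] [:: [:: a; b]; [:: c; d]] i) j.

Lemma mx22_mul (K : pzRingType) (a b c d a' b' c' d' : K) :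
  mx22 a b c d *m mx22 a' b' c' d' =
  mx22 (a * a' + b * c') (a * b' + b * d') (c * a' + d * c') (c * b' + d * d').
Proof.
apply/matrixP => i j; rewrite mxE 2!big_ord_recl big_ord0 addr0 !mxE.
by case: i => -[|[|//]] ?; case: j => -[|[|//]] ?.
Qed.

Lemma map_mx22_tr (V V' : nmodType) (f : V -> V') (a b c d : V) :
  (map_mx f (mx22 a b c d))^T = mx22 (f a) (f c) (f b) (f d).
Proof.
apply/matrixP => i j; rewrite !mxE.
by case: i => -[|[|//]] ?; case: j => -[|[|//]] ?.
Qed.

Definition Phi om : 'M[{poly R[i]}]_2 :=
  mx22 (phi om N) (psi om N)
       ((sl_f om N)%:C *: delta (phi om) N) ((sl_f om N)%:C *: delta (psi om) N).

(* Matrices (A, B) are represented by row_mx A B. *)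
Definition Gam om (M : 'M[R[i]]_(2, 2 + 2)) : {poly R[i]} :=
  \det (map_mx polyC (lsubmx M) + map_mx polyC (rsubmx M) *m Phi om).

(* (y_n, f_n Delta y_n)^T *)
Definition bdry_vec om (y : nat -> R[i]) n : 'cV[R[i]]_2 :=
  \col_(i < 2) [:: y n; (sl_f om n)%:C * delta y n]`_i.

Definition eigenvalue_mx om (M : 'M[R[i]]_(2, 2 + 2)) (lam : R[i]) : Prop :=
  exists y : nat -> R[i],
    [/\ exists2 n, (n <= N.+1)%N & y n != 0,
        sl_equation om lam y &
        lsubmx M *m bdry_vec om y 0 + rsubmx M *m bdry_vec om y N = 0].

Definition simple_eigenvalue_mx om (M : 'M[R[i]]_(2, 2 + 2)) (lam : R[i]) :=
  eigenvalue_mx om M lam /\ mup lam (Gam om M) = 1%N.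

Lemma lsubmx_mul (F : fieldType) (T : 'M[F]_2) (M : 'M[F]_(2, 2 + 2)) :
  lsubmx (T *m M) = T *m lsubmx M.
Proof. by rewrite -[in LHS](hsubmxK M) mul_mx_row row_mxKl. Qed.

Lemma rsubmx_mul (F : fieldType) (T : 'M[F]_2) (M : 'M[F]_(2, 2 + 2)) :
  rsubmx (T *m M) = T *m rsubmx M.
Proof. by rewrite -[in LHS](hsubmxK M) mul_mx_row row_mxKr. Qed.

Lemma simple_eigenvalue_mxMl om T M lam : T \in unitmx ->
  simple_eigenvalue_mx om (T *m M) lam <-> simple_eigenvalue_mx om M lam.
Proof.
move=> uT; have GE : Gam om (T *m M) = (\det T)%:P * Gam om M.
  rewrite /Gam lsubmx_mul rsubmx_mul !map_mxM -mulmxA -mulmxDr det_mulmx.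
  by rewrite det_map_mx.
rewrite /simple_eigenvalue_mx GE mupMr; last by rewrite rootC -unitfE -unitmxE.
split=> -[[y [y0 ye yb]] m1]; split=> //; exists y; split=> //.
  by move: yb; rewrite lsubmx_mul rsubmx_mul -!mulmxA -mulmxDr =>
    /(congr1 (mulmx (invmx T))); rewrite mulKmx// mulmx0.
by rewrite lsubmx_mul rsubmx_mul -!mulmxA -mulmxDr yb mulmx0.
Qed.

End DiscreteSturmLiouville.

Lemma mulmx_unit_congr (F : fieldType) n (T X Y T' : 'M[F]_n) :
  T \in unitmx -> T' \in unitmx ->
  T *m X *m T' = T *m Y *m T' <-> X = Y.
Proof.
move=> uT uT'; split=> [|->//] /(can_inj (mulmxK uT')); exact: (can_inj (mulKmx uT)).
Qed.

Lemma rank2_row_mx (F : fieldType) (A B : 'M[F]_2) :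
  (forall v0 v1 : F, (forall j, v0 * A 0 j + v1 * A 1 j = 0) ->
     (forall j, v0 * B 0 j + v1 * B 1 j = 0) -> v0 = 0 /\ v1 = 0) ->
  \rank (row_mx A B) = 2%N.
Proof.
move=> H; apply/eqP; rewrite -/(row_free _); apply: inj_row_free => v.
rewrite mul_mx_row -[0 in RHS]row_mx0 => /eq_row_mx[eA eB].
have E (M : 'M[F]_2) j : (v *m M) 0 j = v 0 0 * M 0 j + v 0 1 * M 1 j.
  rewrite mxE 2!big_ord_recl big_ord0 addr0.
  by have -> : lift ord0 ord0 = 1 :> 'I_2 by apply/val_inj.
have [||v0 v1] := H (v 0 0) (v 0 1); [by move=> j; rewrite -E eA mxE|
  by move=> j; rewrite -E eB mxE|].
apply/rowP => i; rewrite mxE.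
have [->|->] : i = 0 \/ i = 1 by case: i => -[|[|//]] ?; [left|right]; apply/val_inj.
- exact: v0.
- exact: v1.
Qed.

Section BoundaryConditions.
Variable R : realType.

Definition bc_mx : Type :=
  set_type [set M : 'M[R[i]]_(2, 2 + 2) | \rank M = 2%N].
HB.instance Definition _ := Topological.on bc_mx.
HB.instance Definition _ := Choice.on bc_mx.

Definition bc_rel_def (M M' : bc_mx) : bool :=
  `[< exists2 T : 'M[R[i]]_2, T \in unitmx & val M' = T *m val M >].

Lemma bc_rel_refl : reflexive bc_rel_def.
Proof. by move=> M; apply/asboolP; exists 1%:M; rewrite ?unitmx1 ?mul1mx. Qed.

Lemma bc_rel_sym : symmetric bc_rel_def.
Proof.
move=> M M'; apply/asboolP/asboolP => -[T uT e];
  by exists (invmx T); rewrite ?unitmx_inv// e mulKmx.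
Qed.

Lemma bc_rel_trans : transitive bc_rel_def.
Proof.
move=> M2 M1 M3 /asboolP[T uT e] /asboolP[S uS e']; apply/asboolP.
by exists (S *m T); rewrite ?unitmx_mul ?uS// e' e mulmxA.
Qed.

Canonical bc_rel := EquivRel bc_rel_def bc_rel_refl bc_rel_sym bc_rel_trans.

Definition bc : Type := {eq_quot bc_rel}.
HB.instance Definition _ := Quotient.on bc.
HB.instance Definition _ := Topological.copy bc (quotient_topology bc).

(* a representative (A | B) *)
Definition bc_repr (X : bc) : 'M[R[i]]_(2, 2 + 2) := val (repr X).

Definition symplectic : 'M[R[i]]_2 := mx22 0 1 (-1) 0.

Definition selfadjoint_mx (M : 'M[R[i]]_(2, 2 + 2)) : Prop :=
  let A := lsubmx M in let B := rsubmx M in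
  A *m symplectic *m (map_mx conjc A)^T = B *m symplectic *m (map_mx conjc B)^T.

Lemma selfadjoint_mxMl T M : T \in unitmx ->
  selfadjoint_mx (T *m M) <-> selfadjoint_mx M.
Proof.
move=> uT; have uT' : (map_mx conjc T)^T \in unitmx by rewrite unitmx_tr map_unitmx.
have E A : T *m A *m symplectic *m (map_mx conjc (T *m A))^T =
    T *m (A *m symplectic *m (map_mx conjc A)^T) *m (map_mx conjc T)^T.
  by rewrite map_mxM trmx_mul !mulmxA.
rewrite /selfadjoint_mx lsubmx_mul rsubmx_mul (E (lsubmx M)) (E (rsubmx M)).
exact: mulmx_unit_congr.
Qed.

Lemma bc_repr_pi (M : bc_mx) :
  exists2 T, T \in unitmx & bc_repr (\pi_bc M) = T *m val M.
Proof. by have /eqmodP/asboolP := esym (reprK (\pi_bc M)). Qed.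

Definition selfadjoint_bc : set bc := [set X | selfadjoint_mx (bc_repr X)].

Variant chart_idx := O13 | O14 | O23 | O24.

Definition chart_mx (c : chart_idx) (p : chart_coord R) : 'M[R[i]]_(2, 2 + 2) :=
  let a := p.1.1%:C in let b := p.1.2%:C in
  let z := p.2.1 +i* p.2.2 in
  match c with
  | O13 => row_mx (mx22 1 a 0 z) (mx22 0 z^* (-1) b)
  | O14 => row_mx (mx22 1 a 0 z) (mx22 z^* 0 b 1)
  | O23 => row_mx (mx22 a (-1) z 0) (mx22 0 z^* (-1) b)
  | O24 => row_mx (mx22 a (-1) z 0) (mx22 z^* 0 b 1)
  end.

Lemma chart_mx_rank c p : \rank (chart_mx c p) = 2%N.
Proof.
case: c; apply: rank2_row_mx => v0 v1 /= eA eB.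
- by move: (eA 0) (eB 0); rewrite !mxE /=
    !(mulr1, mulr0, addr0, add0r, mulrN1) => -> /eqP; rewrite oppr_eq0 => /eqP.
- by move: (eA 0) (eB 1); rewrite !mxE /=
    !(mulr1, mulr0, addr0, add0r).
- by move: (eA 1) (eB 0); rewrite !mxE /=
    !(mulr1, mulr0, addr0, add0r, mulrN1) => /eqP+ /eqP; rewrite !oppr_eq0 => /eqP + /eqP.
- by move: (eA 1) (eB 1); rewrite !mxE /=
    !(mulr1, mulr0, addr0, add0r, mulrN1) => /eqP+ ->; rewrite !oppr_eq0 => /eqP.
Qed.

Definition chart (c : chart_idx) (p : chart_coord R) : bc :=
  \pi_bc (exist _ (chart_mx c p) (mem_set (chart_mx_rank c p)) : bc_mx).

Lemma chart_selfadjoint c p : selfadjoint_bc (chart c p).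
Proof.
suff H : selfadjoint_mx (chart_mx c p).
  have [T uT e] := bc_repr_pi (exist _ (chart_mx c p) (mem_set (chart_mx_rank c p))).
  by rewrite /selfadjoint_bc /= e; apply/(selfadjoint_mxMl _ uT).
have cr (x : R) : conjc x%:C = x%:C by rewrite /conjc /= oppr0.
have [c0 c1] : conjc 0 = 0 :> R[i] /\ conjc 1 = 1 :> R[i].
  by rewrite /conjc /= oppr0.
have cN1 : conjc (-1) = -1 :> R[i] by rewrite rmorphN rmorph1.
rewrite /selfadjoint_mx; case: c => /=; rewrite !row_mxKl !row_mxKr;
  rewrite !map_mx22_tr !mx22_mul !(cr, c0, c1, cN1, conjcK);
  rewrite !(mul0r, mulr0, mul1r, mulr1, add0r, addr0, mulNr, mulrN, opprK, oppr0);
  by rewrite ?(addrN, addNr).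
Qed.

End BoundaryConditions.

Section Branch.
Variables (R : realType) (N : nat).
Implicit Types (om : sl_coef R N) (X : bc R).

Definition eigenvalue om X (lam : R[i]) := eigenvalue_mx om (bc_repr X) lam.

Definition simple_eigenvalue om X (lam : R[i]) :=
  simple_eigenvalue_mx om (bc_repr X) lam.

Definition sl_problems : set (sl_coef R N * bc R) :=
  @Omega R N `*` @selfadjoint_bc R.

Definition simple_eigenvalue_branch om X (lam : R)
    (U : set (sl_coef R N * bc R)) (L : sl_coef R N * bc R -> R) : Prop :=
  [/\ U `<=` sl_problems /\ within sl_problems (nbhs (om, X)) U,
      connected U,
      {within U, continuous L},
      L (om, X) = lam &
      forall s, U s -> simple_eigenvalue s.1 s.2 (L s)%:C].

End Branch.

Section Smoothness.
Variables (R : realType) (V : normedModType R).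

(* Meaningful for open U. *)
Fixpoint class_C (k : nat) (U : set V) (f : V -> R) : Prop :=
  if k is k'.+1 then
    (forall x, U x -> differentiable f x) /\
    (forall v, class_C k' U ('D_v f))
  else {within U, continuous f}.

Definition smooth (U : set V) (f : V -> R) := forall k, class_C k U f.

End Smoothness.

(* U need not be open: smoothness is asserted on its (relative) interior, read
   in each chart; for relatively open U the interior below is the full chart
   domain. *)
Definition smooth_on_problems (R : realType) (N : nat)
    (U : set (sl_coef R N * bc R)) (L : sl_coef R N * bc R -> R) : Prop :=
  forall c : chart_idx,
    smooth
      (interior [set s : (sl_coef R N * chart_coord R)%type |
                   U (s.1, chart c s.2)])
      (fun s => L (s.1, chart c s.2)).

(* Main.v *)
Require Import Defs.
From HB Require Import structures.
From mathcomp Require Import all_boot all_order all_algebra complex.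
From mathcomp Require Import all_classical all_reals all_analysis.
From mathcomp Require Import ring.

Set Implicit Arguments.
Unset Strict Implicit.
Unset Printing Implicit Defensive.

Import Order.TTheory GRing.Theory Num.Theory.
Import numFieldNormedType.Exports.

Local Open Scope classical_set_scope.
Local Open Scope ring_scope.
Local Open Scope complex_scope.

(** The branch is a simple root of a polynomial that depends smoothly on the
problem, so its smoothness is a case of the implicit function theorem; because
the branch is assumed continuous, no existence statement is needed and the
theorem reduces to a computation with divided differences.

Fix a chart.  Replacing a representative (A | B) by the matrix of the chart
multiplies Gamma by a nonzero constant, so L is a simple root of
Gamma = det (A + B Phi_N) with (A | B) read off from the four real coordinates.
The recursion for phi and psi uses the coefficients only through 1/f_n, q_n,
w_n, and f_N Delta phi_N is the second component of that recursion as soon as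
f_N does not vanish.  Hence the real and imaginary parts of the coefficients of
Gamma are polynomials in the real coordinates of the problem ([smooth_poly_Gam]).

Let p_s be a real polynomial whose coefficients are smooth in s, let G be
continuous with p_s(G(s)) = 0, and fix s0.  Dividing p_s(y) - p_s(x) by y - x
gives a polynomial K, and
    0 - p_s(G(s0)) = (G(s) - G(s0)) K(s, G(s0), G(s)),
where K is continuous in s and equals p_s0'(G(s0)) != 0 at s0.  So, near s0,
    G(s) = G(s0) - K(s, G(s0), G(s))^-1 p_s(G(s0)),
a constant minus a continuous function times a differentiable one that vanishes
at s0.  Such a product is differentiable ([differentiable_continuousM]), and
this gives the usual formula for the derivative of an implicit function
([root_derive]).  Its right-hand side involves only G and smooth functions, so G
is of class C^k+1 whenever it is of class C^k ([smooth_root]).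

Gamma has complex coefficients while L is real.  At a simple root the derivative
of the real part or that of the imaginary part of Gamma is nonzero, and the
real theorem applies to that part; the two open sets so obtained cover the
domain ([smooth_complex_root]). *)

(** * Differentiability of real functions *)

Section Differential.
Variables (R : realType) (V : normedModType R).
Implicit Types f g : V -> R.

Lemma diff_approx f x e : differentiable f x -> 0 < e ->
  \forall y \near x, `|f y - f x - 'd f x (y - x)| <= e * `|y - x|.
Proof.
move=> df e0; have /eqaddoP/(_ e e0) := diff_locally df.
rewrite [X in X -> _](near_shift x) sub0r; apply: filterS => y /=.
by rewrite !fctE /= subrK opprD addrA.
Qed.

Lemma approx_is_diff f x (l : {linear V -> R}) : continuous l ->
  (forall e, 0 < e -> \forall y \near x, `|f y - f x - l (y - x)| <= e * `|y - x|) ->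
  is_diff x f l.
Proof.
move=> cl H.
have E : f \o shift x = cst (f x) + l +o_ 0 id.
  apply/eqaddoP => e e0; rewrite [\forall x \near _, _ <= _](near_shift x) sub0r.
  apply: filterS (H e e0) => y /=.
  by rewrite !fctE /= subrK opprD addrA.
have dE := diff_unique cl E.
by split=> //; apply/diff_locallyP; rewrite dE.
Qed.

Lemma near_eq_differentiable f g x :
  (\near x, f x = g x) -> differentiable f x -> differentiable g x.
Proof.
move=> fg df; suff dg : is_diff x g ('d f x) by exact: (@ex_diff _ _ _ _ _ _ _ dg).
apply: approx_is_diff; first exact: diff_continuous.
move=> e e0; have := diff_approx df e0; have fgx := nbhs_singleton fg.
by apply: filterS2 fg => y fgy; rewrite fgy fgx.
Qed.

(** The product rule in the case where one factor is only continuous: at a zero of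
[f] the increments of [g] are multiplied by [f y = O(y - x)], so they contribute
only a little-o. *)
Lemma differentiable_continuousM f g x : {for x, continuous g} ->
  differentiable f x -> f x = 0 ->
  is_diff x (fun y => g y * f y) (g x \*: 'd f x).
Proof.
move=> cg df fx0.
have -> : (g x \*: 'd f x) = 'd (fun y => g x * f y) x :> (V -> R).
  exact/esym/(@diffZ _ _ _ f (g x) x df).
have dgf : differentiable (fun y => g x * f y) x by exact: (@differentiableZ _ _ _ f).
(* the slope C is any bound for the differential plus 1 *)
have [C C0 HC] : exists2 C, 0 < C & \forall y \near x, `|f y| <= C * `|y - x|.
  have [C C0 HC] := linear_lipschitz (diff_continuous df).
  exists (1 + C); first by rewrite addr_gt0.
  have := diff_approx df ltr01; apply: filterS => y.
  rewrite fx0 subr0 mulrDl => H.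
  rewrite -[f y](subrK ('d f x (y - x))); apply: le_trans (ler_normD _ _) _.
  exact: lerD H (HC _).
apply: approx_is_diff; first exact: diff_continuous.
move=> e e0.
near=> y; rewrite fx0 !mulr0 subr0.
have -> : g y * f y - 'd (fun y => g x * f y) x (y - x) =
  (g y - g x) * f y + (g x * f y - 0 - 'd (fun y => g x * f y) x (y - x)) by ring.
apply: le_trans (ler_normD _ _) _.
rewrite [e]splitr [leRHS]mulrDl; apply: lerD; last first.
  rewrite -{1}(mulr0 (g x)) -{1}fx0; near: y.
  by apply: (diff_approx dgf); rewrite divr_gt0.
rewrite normrM; apply: (@le_trans _ _ (e / 2 / C * (C * `|y - x|))).
  apply: ler_pM => //; last by near: y.
  rewrite distrC; apply/ltW; near: y.
  by move/cvgrPdist_lt : cg; apply; rewrite !divr_gt0.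
by rewrite mulrA divfK// gt_eqF.
Unshelve. all: by end_near. Qed.

End Differential.

(** * Closure properties of the classes C^k *)

Section ClassC.
Variables (R : realType) (V : normedModType R) (W : set V).
Hypothesis oW : open W.
Implicit Types f g : V -> R.

Lemma class_CSW k f : class_C k.+1 W f -> class_C k W f.
Proof.
elim: k f => [|k IH] f [df Df]; last by split=> // v; apply/IH/Df.
rewrite /= continuous_open_subspace// => x /set_mem Wx.
exact/differentiable_continuous/df.
Qed.

Lemma class_C_continuous k f x : class_C k W f -> W x -> {for x, continuous f}.
Proof.
elim: k f => [|k IH] f; last by move=> /class_CSW; exact: IH.
by rewrite /= continuous_open_subspace// => cf /mem_set; exact: cf.
Qed.

Lemma near_open x : W x -> \forall y \near x, W y.
Proof. by move=> Wx; apply: open_nbhs_nbhs. Qed.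

Lemma eq_on_near f g x : {in W, f =1 g} -> W x -> \near x, f x = g x.
Proof. by move=> fg /near_open; apply: filterS => y /mem_set /fg. Qed.

(** The values of [f] outside the open set [W] are irrelevant, which lets a
derivative be replaced by the formula that computes it on [W] only. *)
Lemma eq_on_class_C k f g : {in W, f =1 g} -> class_C k W f -> class_C k W g.
Proof.
elim: k f g => [|k IH] f g fg.
  by move=> cf; apply: subspace_eq_continuous cf.
move=> [df Df]; split=> [x Wx|v].
  by apply: near_eq_differentiable (df x Wx); exact: eq_on_near.
apply: IH (Df v) => x /set_mem Wx.
by apply: near_eq_derive; exact: eq_on_near.
Qed.

Lemma class_C_cst k (c : R) : class_C k W (fun=> c).
Proof.
elim: k c => [|k IH] c.
  by rewrite /= continuous_open_subspace// => x _; exact: cst_continuous.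
split=> [x _|v]; first exact: differentiable_cst.
by apply: eq_on_class_C (IH 0) => x _; rewrite derive_cst.
Qed.

Lemma class_CD k f g : class_C k W f -> class_C k W g ->
  class_C k W (fun x => f x + g x).
Proof.
elim: k f g => [|k IH] f g.
  rewrite /= !continuous_open_subspace// => cf cg x Wx.
  by apply: continuousD; [exact: cf|exact: cg].
move=> [df Df] [dg Dg]; split=> [x Wx|v].
  by apply: differentiableD; [exact: df|exact: dg].
apply: eq_on_class_C (IH _ _ (Df v) (Dg v)) => x /set_mem Wx.
by rewrite (@deriveD _ _ _ f g)//; apply: diff_derivable; auto.
Qed.

Lemma class_CM k f g : class_C k W f -> class_C k W g ->
  class_C k W (fun x => f x * g x).
Proof.
elim: k f g => [|k IH] f g.
  rewrite /= !continuous_open_subspace// => cf cg x Wx.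
  by apply: continuousM; [exact: cf|exact: cg].
move=> Cf Cg; have [[df Df] [dg Dg]] := (Cf, Cg); split=> [x Wx|v].
  by apply: differentiableM; [exact: df|exact: dg].
apply: eq_on_class_C (class_CD (IH _ _ (class_CSW Cf) (Dg v))
  (IH _ _ (class_CSW Cg) (Df v))) => x /set_mem Wx.
by rewrite (@deriveM _ _ f g)//; apply: diff_derivable; auto.
Qed.

Lemma class_CN k f : class_C k W f -> class_C k W (fun x => - f x).
Proof.
move=> /(class_CM (class_C_cst k (-1))).
by apply: eq_on_class_C => x _; rewrite mulN1r.
Qed.

Lemma class_CV k f : (forall x, W x -> f x != 0) -> class_C k W f ->
  class_C k W (fun x => (f x)^-1).
Proof.
move=> f0; elim: k => [|k IH] Cf.
  move: Cf; rewrite /= !continuous_open_subspace// => cf x Wx.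
  by apply: continuousV; [exact/f0/set_mem|exact: cf].
have [df Df] := Cf; split=> [x Wx|v].
  by apply: differentiableV; auto.
have CV := IH (class_CSW Cf).
apply: eq_on_class_C (class_CM (class_CN (class_CM CV CV)) (Df v)) => x /set_mem Wx.
rewrite deriveV; [|exact: f0|by apply: diff_derivable; auto].
by rewrite /GRing.scale /= expr2 invfM.
Qed.

Lemma class_C_sum k n (f : 'I_n -> V -> R) : (forall i, class_C k W (f i)) ->
  class_C k W (fun x => \sum_(i < n) f i x).
Proof.
move=> Cf; elim: n f Cf => [|n IH] f Cf.
  by apply: eq_on_class_C (class_C_cst k 0) => x _; rewrite big_ord0.
apply: eq_on_class_C (class_CD (IH _ _) (Cf ord_max)) => [x _|i].
  by rewrite big_ord_recr.
exact: Cf.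
Qed.

Lemma class_CX k f n : class_C k W f -> class_C k W (fun x => f x ^+ n).
Proof.
move=> Cf; elim: n => [|n IH]; first exact: class_C_cst.
by apply: eq_on_class_C (class_CM Cf IH) => x _; rewrite exprS.
Qed.

Lemma smooth_linear (f : V -> R) : linear f -> continuous f -> smooth W f.
Proof.
move=> lf; pose fM := GRing.isLinear.Build _ _ _ _ _ lf.
pose l : {linear V -> R} := HB.pack f fM; rewrite -[f]/(l : V -> R).
move=> cl [|k]; first by rewrite /= continuous_open_subspace// => x _; exact: cl.
split=> [x _|v]; first exact: linear_differentiable.
apply: eq_on_class_C (class_C_cst k (l v)) => x _.
by rewrite deriveE ?diff_lin//; exact: linear_differentiable.
Qed.

End ClassC.

Lemma class_C_subset (R : realType) (V : normedModType R) (A B : set V) k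
  (f : V -> R) : A `<=` B -> class_C k B f -> class_C k A f.
Proof.
move=> AB; elim: k f => [|k IH] f; first exact: continuous_subspaceW.
by move=> [df Df]; split=> [x /AB/df//|v]; exact: IH (Df v).
Qed.

Lemma class_CU (R : realType) (V : normedModType R) (A B : set V) k (f : V -> R) :
  open A -> open B -> class_C k A f -> class_C k B f -> class_C k (A `|` B) f.
Proof.
move=> oA oB; elim: k f => [|k IH] f.
  rewrite /= !continuous_open_subspace//; last exact: openU.
  by move=> cA cB x /set_mem [|] /mem_set; [exact: cA|exact: cB].
move=> [dA DA] [dB DB]; split=> [x [|]|v]; [exact: dA|exact: dB|].
exact: IH (DA v) (DB v).
Qed.

(** * Simple roots of real polynomials with smooth coefficients *)

Section ImplicitRoot.

(** The quotient of [p.[y] - p.[x]] by [y - x], written without division so that it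
makes sense for [y = x].  The bound [n] on the size of [p] is a parameter so
that the formula stays uniform over a family of polynomials. *)
Definition divdiff (R : comNzRingType) (p : {poly R}) n x y : R :=
  \sum_(j < n) p`_j * \sum_(i < j) y ^+ (j.-1 - i) * x ^+ i.

Lemma divdiffP (R : comNzRingType) (p : {poly R}) n x y : (size p <= n)%N ->
  p.[y] - p.[x] = (y - x) * divdiff p n x y.
Proof.
move=> pn; rewrite !(horner_coef_wide _ pn) -sumrB mulr_sumr.
by apply: eq_bigr => j _; rewrite -mulrBr subrXX mulrCA.
Qed.

Lemma deriv_horner_wide (R : comNzRingType) (p : {poly R}) n x :
  (size p <= n)%N -> p^`().[x] = \sum_(j < n) p`_j * (x ^+ j.-1 *+ j).
Proof.
move=> pn; have {1}-> : p = \sum_(j < n) p`_j *: 'X^j.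
  rewrite -poly_def; apply/polyP => i; rewrite coef_poly.
  by case: ltnP => // ni; rewrite nth_default// (leq_trans pn).
rewrite raddf_sum horner_sum; apply: eq_bigr => j _ /=.
by rewrite derivZ derivXn hornerZ hornerMn hornerXn.
Qed.

Lemma divdiff_diag (R : comNzRingType) (p : {poly R}) n x : (size p <= n)%N ->
  divdiff p n x x = p^`().[x].
Proof.
move=> pn; rewrite (deriv_horner_wide _ pn); apply: eq_bigr => j _.
rewrite (eq_bigr (fun=> x ^+ j.-1)) ?sumr_const ?card_ord// => i _.
by rewrite -exprD subnK// -ltnS (leq_trans (ltn_ord i))// leqSpred.
Qed.

Variables (R : realType) (V : normedModType R) (W : set V).
Hypothesis oW : open W.
Variables (p : V -> {poly R}) (n : nat) (G : V -> R).
Hypothesis size_p : forall s, (size (p s) <= n)%N.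
Hypothesis smooth_p : forall j, smooth W (fun s => (p s)`_j).

Lemma class_C_deriv_horner k : class_C k W G ->
  class_C k W (fun s => (p s)^`().[G s]).
Proof.
move=> CG.
have CS : class_C k W (fun s => \sum_(j < n) (p s)`_j * (G s ^+ j.-1 *+ j)).
  apply: class_C_sum => // j; apply: class_CM => //; first exact: smooth_p.
  apply: (@eq_on_class_C _ _ _ oW _ (fun s => G s ^+ j.-1 * j%:R)) => [s _|].
    by rewrite mulr_natr.
  by apply: class_CM => //; [exact: class_CX|exact: class_C_cst].
by apply: eq_on_class_C CS => // s _; rewrite (deriv_horner_wide _ (size_p s)).
Qed.

Hypothesis cont_G : {within W, continuous G}.
Hypothesis root_G : forall s, W s -> root (p s) (G s).
Hypothesis simple_G : forall s, W s -> (p s)^`().[G s] != 0.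

Lemma horner_is_diff s x : W s -> differentiable (fun t => (p t).[x]) s /\
  forall v, 'D_v (fun t => (p t).[x]) s =
    \sum_(j < n) 'D_v (fun t => (p t)`_j) s * x ^+ j.
Proof.
move=> Ws.
have dp (j : 'I_n) : differentiable (fun t => (p t)`_j * x ^+ j) s.
  apply: differentiableM; last exact: differentiable_cst.
  by have [+ _] := smooth_p j 1; apply.
have -> : (fun t => (p t).[x]) = \sum_(j < n) (fun t => (p t)`_j * x ^+ j).
  by apply/funext => t; rewrite (horner_coef_wide _ (size_p t)) fct_sumE.
split=> [|v]; first exact: differentiable_sum.
rewrite derive_sum => [|j]; last exact: diff_derivable.
apply: eq_bigr => j _.
rewrite (@deriveM _ _ (fun t => (p t)`_j) (cst (x ^+ j))).
- by rewrite derive_cst scaler0 add0r mulrC.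
- by apply: diff_derivable; have [+ _] := smooth_p j 1; apply.
- exact: derivable_cst.
Qed.

(** Near [s], [G] is the constant [G s] minus the continuous function [1 / K] times
[fun t => (p t).[G s]], which is differentiable and vanishes at [s]. *)
Lemma root_derive s : W s -> differentiable G s /\ forall v,
  'D_v G s = - ((p s)^`().[G s])^-1 *
             \sum_(j < n) 'D_v (fun t => (p t)`_j) s * G s ^+ j.
Proof.
move=> Ws; pose K t := divdiff (p t) n (G s) (G t).
have cG : {for s, continuous G} by exact: class_C_continuous (cont_G : class_C 0 W G) Ws.
have Ks : K s = (p s)^`().[G s] by rewrite /K divdiff_diag.
have Ks0 : K s != 0 by rewrite Ks simple_G.
have cK : {for s, continuous K}.
  have Cs : class_C 0 W K.
    apply: class_C_sum => // j; apply: class_CM => //; first exact: smooth_p.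
    apply: class_C_sum => // i; apply: class_CM => //; last exact: class_C_cst.
    exact: class_CX.
  exact: class_C_continuous Cs Ws.
have [dP DP] := horner_is_diff (G s) Ws.
have P0 : (p s).[G s] = 0 by exact/rootP/root_G.
have cV : {for s, continuous (fun t => (K t)^-1)} by exact: continuousV.
have dQ := differentiable_continuousM cV dP P0.
(* dividing p_t(G t) - p_t(G s) = - p_t(G s) by the nonzero K t *)
have GE : \forall t \near s, G s - (K t)^-1 * (p t).[G s] = G t.
  have K0 : \forall t \near s, K t != 0.
    exact: cvgr_neq0 cK Ks0.
  have Wn := near_open oW Ws.
  apply: filterS2 Wn K0 => t Wt Kt.
  have := divdiffP (G s) (G t) (size_p t).
  rewrite (rootP (root_G Wt)) sub0r -/(K t) => /eqP.
  rewrite eqr_oppLR => /eqP ->.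
  by rewrite mulrN opprK mulrCA mulVf// mulr1 subrKC.
have dG : is_diff s (fun t => G s - (K t)^-1 * (p t).[G s])
                    (- ((K s)^-1 \*: 'd (fun t => (p t).[G s]) s)).
  have := is_diffB (is_diff_cst (G s) s) dQ.
  by rewrite sub0r; exact.
split.
  by apply: near_eq_differentiable GE _; exact: ex_diff.
move=> v.
rewrite -(near_eq_derive v GE) deriveE; last exact: ex_diff.
rewrite diff_val -Ks -DP deriveE//.
by rewrite mulNr.
Qed.

(** Bootstrapping: the derivative given by [root_derive] is a rational expression in
[G] and in smooth functions, so it has the regularity already known for [G]. *)
Theorem smooth_root : smooth W G.
Proof.
elim=> [//|k IH]; split=> [s /root_derive[]//|v].
have Cp : forall j, class_C k W ('D_v (fun t => (p t)`_j)).
  by move=> j; have [_ +] := smooth_p j k.+1; apply.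
have Cd := class_C_deriv_horner IH.
have CS : class_C k W (fun s =>
    \sum_(j < n) 'D_v (fun t => (p t)`_j) s * G s ^+ j).
  by apply: class_C_sum => // j; apply: class_CM => //; exact: class_CX.
have := class_CM oW (class_CN oW (class_CV oW simple_G Cd)) CS.
by apply: eq_on_class_C => // s /set_mem Ws; have [_ ->] := root_derive Ws.
Qed.

End ImplicitRoot.

(** * Complex polynomials with smooth coefficients *)

Section ComplexFamilies.
Variables (R : realType) (V : normedModType R) (W : set V).
Hypothesis oW : open W.

Definition smoothC (f : V -> R[i]) : Prop :=
  smooth W (fun s => complex.Re (f s)) /\ smooth W (fun s => complex.Im (f s)).

Implicit Types f g : V -> R[i].

Lemma smoothC_real (f : V -> R) : smooth W f -> smoothC (fun s => (f s)%:C).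
Proof. by move=> Cf; split=> // k; exact: class_C_cst. Qed.

Lemma smoothC_cst (c : R[i]) : smoothC (fun=> c).
Proof. by split=> k; exact: class_C_cst. Qed.

Lemma smoothCD f g : smoothC f -> smoothC g -> smoothC (fun s => f s + g s).
Proof.
move=> [rf jf] [rg jg]; split=> k.
  by apply: eq_on_class_C (class_CD oW (rf k) (rg k)) => // s _; case: (f s); case: (g s).
by apply: eq_on_class_C (class_CD oW (jf k) (jg k)) => // s _; case: (f s); case: (g s).
Qed.

Lemma smoothCM f g : smoothC f -> smoothC g -> smoothC (fun s => f s * g s).
Proof.
move=> [rf jf] [rg jg]; split=> k.
  have := class_CD oW (class_CM oW (rf k) (rg k)) (class_CN oW (class_CM oW (jf k) (jg k))).
  by apply: eq_on_class_C => // s _; case: (f s); case: (g s).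
have := class_CD oW (class_CM oW (rf k) (jg k)) (class_CM oW (jf k) (rg k)).
by apply: eq_on_class_C => // s _; case: (f s); case: (g s).
Qed.

Lemma smoothC_conj f : smoothC f -> smoothC (fun s => conjc (f s)).
Proof.
move=> [rf jf]; split=> k.
  by apply: eq_on_class_C (rf k) => // s _; case: (f s).
by apply: eq_on_class_C (class_CN oW (jf k)) => // s _; case: (f s).
Qed.

Lemma smoothC_sum n (F : 'I_n -> V -> R[i]) : (forall i, smoothC (F i)) ->
  smoothC (fun s => \sum_(i < n) F i s).
Proof.
move=> CF; suff -> : (fun s => \sum_(i < n) F i s) = \sum_(i < n) F i.
  apply: (big_ind smoothC); [exact: smoothC_cst|exact: smoothCD|by []].
by apply/funext => s; rewrite fct_sumE.
Qed.

(** The uniform bound on the degree makes evaluation a sum with a fixed number of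
terms. *)
Definition smooth_poly (p : V -> {poly R[i]}) : Prop :=
  (exists n, forall s, (size (p s) <= n)%N) /\
  forall j, smoothC (fun s => (p s)`_j).

Implicit Types p q : V -> {poly R[i]}.

Lemma smooth_polyC f : smoothC f -> smooth_poly (fun s => (f s)%:P).
Proof.
move=> Cf; split; first by exists 1%N => s; exact: size_polyC_leq1.
case=> [|j]; under eq_fun do rewrite coefC /=; first exact: Cf.
exact: smoothC_cst.
Qed.

Lemma smooth_poly_cst (c : {poly R[i]}) : smooth_poly (fun=> c).
Proof. by split; [exists (size c)|move=> j; exact: smoothC_cst]. Qed.

Lemma smooth_polyD p q : smooth_poly p -> smooth_poly q ->
  smooth_poly (fun s => p s + q s).
Proof.
move=> [[m pm] Cp] [[n qn] Cq]; split.
  exists (maxn m n) => s; apply: leq_trans (size_polyD _ _) _.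
  by rewrite geq_max !leq_max pm qn orbT.
by move=> j; under eq_fun do rewrite coefD; exact: smoothCD.
Qed.

Lemma smooth_polyM p q : smooth_poly p -> smooth_poly q ->
  smooth_poly (fun s => p s * q s).
Proof.
move=> [[m pm] Cp] [[n qn] Cq]; split.
  exists (m + n)%N => s; apply: leq_trans (size_polyMleq _ _) _.
  by apply: leq_trans (leq_pred _) _; exact: leq_add.
move=> j; under eq_fun do rewrite coefM.
by apply: smoothC_sum => i; exact: smoothCM.
Qed.

Lemma smooth_polyZ f p : smoothC f -> smooth_poly p ->
  smooth_poly (fun s => f s *: p s).
Proof.
move=> Cf Cp; under eq_fun do rewrite -mul_polyC.
by apply: smooth_polyM => //; exact: smooth_polyC.
Qed.

Lemma smooth_poly_sum (I : finType) (F : I -> V -> {poly R[i]}) :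
  (forall i, smooth_poly (F i)) -> smooth_poly (fun s => \sum_i F i s).
Proof.
move=> CF; suff -> : (fun s => \sum_i F i s) = \sum_i F i.
  by apply: (big_ind smooth_poly); [exact: smooth_poly_cst|exact: smooth_polyD|].
by apply/funext => s; rewrite fct_sumE.
Qed.

Lemma smooth_poly_prod (I : finType) (F : I -> V -> {poly R[i]}) :
  (forall i, smooth_poly (F i)) -> smooth_poly (fun s => \prod_i F i s).
Proof.
move=> CF; rewrite unlock; elim: (index_enum I) => [|i r IH] /=.
  exact: smooth_poly_cst.
exact: smooth_polyM.
Qed.

Definition smooth_mx m n (A : V -> 'M[{poly R[i]}]_(m, n)) : Prop :=
  forall i j, smooth_poly (fun s => A s i j).

Lemma smooth_mxD m n (A B : V -> 'M[{poly R[i]}]_(m, n)) :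
  smooth_mx A -> smooth_mx B -> smooth_mx (fun s => A s + B s).
Proof. by move=> CA CB i j; under eq_fun do rewrite mxE; exact: smooth_polyD. Qed.

Lemma smooth_mxM m n l (A : V -> 'M[{poly R[i]}]_(m, n)) (B : V -> 'M[{poly R[i]}]_(n, l)) :
  smooth_mx A -> smooth_mx B -> smooth_mx (fun s => A s *m B s).
Proof.
move=> CA CB i j; under eq_fun do rewrite mxE.
by apply: smooth_poly_sum => k; exact: smooth_polyM.
Qed.

Lemma smooth_det n (A : V -> 'M[{poly R[i]}]_n) :
  smooth_mx A -> smooth_poly (fun s => \det (A s)).
Proof.
move=> CA; apply: smooth_poly_sum => t; apply: smooth_polyM.
  exact: smooth_poly_cst.
exact: smooth_poly_prod.
Qed.

Lemma smooth_mx_polyC m n (A : V -> 'M[R[i]]_(m, n)) :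
  (forall i j, smoothC (fun s => A s i j)) ->
  smooth_mx (fun s => map_mx polyC (A s)).
Proof. by move=> CA i j; under eq_fun do rewrite mxE; exact: smooth_polyC. Qed.

End ComplexFamilies.

(** * Real simple roots of complex polynomials with smooth coefficients *)

Section ComplexRoot.
Variable R : realType.

(** [h] stands for the real part or the imaginary part.  Since [h] is linear over
the reals, applying it to the coefficients commutes with evaluation at a real
point and with differentiation; a real root of [q] remains a root, and it is
simple wherever [h] of the derivative is nonzero. *)
Section RealCoordinate.
Variable h : R[i] -> R.
Hypothesis hD : {morph h : a b / a + b}.
Hypothesis hM : forall a x, h (a * x%:C) = h a * x.

Let h0 : h 0 = 0.
Proof. by rewrite -[in LHS](mul0r 0%:C) hM mulr0. Qed.

Lemma map_poly_coord_horner (q : {poly R[i]}) x :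
  (map_poly h q).[x] = h q.[x%:C].
Proof.
rewrite (@horner_coef_wide _ (size q)) ?size_poly// horner_coef.
rewrite (big_morph h hD h0); apply: eq_bigr => j _.
by rewrite coef_map_id0// -rmorphXn hM.
Qed.

Lemma map_poly_coord_deriv (q : {poly R[i]}) :
  (map_poly h q)^`() = map_poly h q^`().
Proof.
apply/polyP => j; rewrite coef_deriv !coef_map_id0// coef_deriv.
by move: q`_j.+1 => c; elim: j.+1 => [|m IH]; rewrite ?mulr0n ?h0// !mulrS hD IH.
Qed.

Variables (V : normedModType R) (W : set V).
Hypothesis oW : open W.
Variables (p : V -> {poly R[i]}) (G : V -> R).
Hypothesis smooth_hp : forall j, smooth W (fun s => h (p s)`_j).
Hypothesis size_p : exists n, forall s, (size (p s) <= n)%N.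
Hypothesis cont_G : {within W, continuous G}.
Hypothesis root_G : forall s, W s -> root (p s) (G s)%:C.

Let Wh := [set s | W s /\ h (p s)^`().[(G s)%:C] != 0].

Lemma smooth_root_coord : open Wh /\ smooth Wh G.
Proof.
have [n pn] := size_p.
have hpn s : (size (map_poly h (p s)) <= n)%N by rewrite (leq_trans (size_poly _ _)).
have smooth_h j : smooth W (fun s => (map_poly h (p s))`_j).
  by under eq_fun do rewrite coef_map_id0//; exact: smooth_hp.
have derivE s : (map_poly h (p s))^`().[G s] = h (p s)^`().[(G s)%:C].
  by rewrite map_poly_coord_deriv map_poly_coord_horner.
have oWh : open Wh.
  have C0 := class_C_deriv_horner oW hpn smooth_h (cont_G : class_C 0 W G).
  have cd : {in W, continuous (fun s => (map_poly h (p s))^`().[G s])}.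
    by move: C0; rewrite /= continuous_open_subspace.
  have /(continuous_inP _ oW)/(_ _ (@open_neq R 0)) := cd.
  congr open; apply/seteqP; split=> s /=; rewrite derivE.
  - by move=> [].
  - by move=> [].
split=> //; have WhW : Wh `<=` W by move=> s [].
apply: (smooth_root oWh hpn).
- by move=> j k; apply: class_C_subset (smooth_h j k).
- exact: continuous_subspaceW cont_G.
- move=> s [Ws _]; apply/rootP.
  by rewrite map_poly_coord_horner (rootP (root_G Ws)).
- by move=> s [_]; rewrite derivE.
Qed.

End RealCoordinate.

Theorem smooth_complex_root (V : normedModType R) (W : set V)
  (p : V -> {poly R[i]}) (G : V -> R) : open W -> smooth_poly W p ->
  {within W, continuous G} ->
  (forall s, W s -> root (p s) (G s)%:C) ->
  (forall s, W s -> (p s)^`().[(G s)%:C] != 0) ->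
  smooth W G.
Proof.
move=> oW [size_p Cp] cG rG sG.
have ReD : {morph @complex.Re R : a b / a + b} by case=> [? ?] [? ?].
have ImD : {morph @complex.Im R : a b / a + b} by case=> [? ?] [? ?].
have ReM (a : R[i]) x : complex.Re (a * x%:C) = complex.Re a * x.
  by case: a => a b /=; rewrite mulr0 subr0.
have ImM (a : R[i]) x : complex.Im (a * x%:C) = complex.Im a * x.
  by case: a => a b /=; rewrite mulr0 add0r.
have [oRe CRe] := smooth_root_coord ReD ReM oW (fun j => (Cp j).1) size_p cG rG.
have [oIm CIm] := smooth_root_coord ImD ImM oW (fun j => (Cp j).2) size_p cG rG.
move=> k; apply: class_C_subset (class_CU oRe oIm (CRe k) (CIm k)) => s Ws.
have := sG s Ws; rewrite eq_complex negb_and.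
by move=> /orP[?|?]; [left|right]; split.
Qed.

End ComplexRoot.

Lemma mup1_root (K : fieldType) (q : {poly K}) x : mup x q = 1%N ->
  root q x /\ q^`().[x] != 0.
Proof.
move=> m1; have q0 : q != 0.
  apply: contra_eq_neq m1 => ->; rewrite /mup.
  case: arg_maxnP => //= i _ _.
  by rewrite ltn_eqF// (leq_trans (ltn_ord i))// size_poly0.
have rq : root q x by rewrite -dvdp_XsubCl XsubC_dvd// m1.
split=> //; have := mup_leq x 1 q0; rewrite m1 leqnn => /esym.
apply: contra => dq; have /factor_theorem[r qE] := rq.
move: dq; rewrite qE derivM derivXsubC mulr1 hornerD hornerM hornerXsubC subrr.
rewrite mulr0 add0r => /factor_theorem[t ->].
by rewrite -mulrA -expr2 dvdp_mulIr.
Qed.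

(** * The characteristic polynomial in a chart *)

Section CharacteristicPolynomial.
Variables (R : realType) (N : nat).
Local Notation param := (sl_coef R N * chart_coord R)%type.

Lemma row_nth_linear m (k : nat) : linear (fun v : 'rV[R]_m => row_nth v k).
Proof.
move=> a u v; rewrite /row_nth; case: insub => [i|]; first by rewrite !mxE.
by rewrite scaler0 addr0.
Qed.

Lemma row_nth_continuous m (k : nat) : continuous (fun v : 'rV[R]_m => row_nth v k).
Proof.
rewrite /row_nth; case: insub => [i|]; first exact: coord_continuous.
exact: cst_continuous.
Qed.

Lemma comp_fst_continuous (A B C : topologicalType) (f : A -> C) :
  continuous f -> continuous (fun x : A * B => f x.1).
Proof. by move=> cf x; apply: continuous_comp; [exact: cvg_fst|exact: cf]. Qed.

Lemma comp_snd_continuous (A B C : topologicalType) (f : B -> C) :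
  continuous f -> continuous (fun x : A * B => f x.2).
Proof. by move=> cf x; apply: continuous_comp; [exact: cvg_snd|exact: cf]. Qed.

Variable W : set param.
Hypothesis oW : open W.

Lemma smooth_sl_f k : smooth W (fun s : param => (sl_f s.1 k)^-1).
Proof.
under eq_fun do rewrite invrK.
apply: smooth_linear => // [a u v|]; first exact: (row_nth_linear k a u.1.1.1).
apply: (comp_fst_continuous (f := fun v => row_nth v.1.1 k)).
apply: (comp_fst_continuous (f := fun v => row_nth v.1 k)).
apply: (comp_fst_continuous (f := (@row_nth R _)^~ k)); exact: row_nth_continuous.
Qed.

Lemma smooth_sl_q k : smooth W (fun s : param => sl_q s.1 k).
Proof.
apply: smooth_linear => // [a u v|]; first exact: (row_nth_linear k.-1 a u.1.1.2).
apply: (comp_fst_continuous (f := fun v => row_nth v.1.2 k.-1)).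
apply: (comp_fst_continuous (f := fun v => row_nth v.2 k.-1)).
apply: (comp_snd_continuous (f := (@row_nth R _)^~ k.-1)); exact: row_nth_continuous.
Qed.

Lemma smooth_sl_w k : smooth W (fun s : param => sl_w s.1 k).
Proof.
apply: smooth_linear => // [a u v|]; first exact: (row_nth_linear k.-1 a u.1.2).
apply: (comp_fst_continuous (f := fun v => row_nth v.2 k.-1)).
apply: (comp_snd_continuous (f := (@row_nth R _)^~ k.-1)); exact: row_nth_continuous.
Qed.

Lemma smooth_poly_sl_ivp a b k :
  smooth_poly W (fun s : param => (sl_ivp s.1 a b k).1) /\
  smooth_poly W (fun s : param => (sl_ivp s.1 a b k).2).
Proof.
elim: k => [|k [IH1 IH2]] /=; first by split; exact: smooth_poly_cst.
have Cy : smooth_poly W (fun s : param => (sl_ivp s.1 a b k.+1).1).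
  apply: smooth_polyD => //; apply: smooth_polyZ => //.
  exact/smoothC_real/smooth_sl_f.
split=> //; apply: smooth_polyD => //; apply: smooth_polyM => //.
apply: smooth_polyD => //; first exact/smooth_polyC/smoothC_real/smooth_sl_q.
under eq_fun do rewrite -scaleNr.
apply: smooth_polyZ => //; last exact: smooth_poly_cst.
under eq_fun do rewrite -rmorphN.
by apply: smoothC_real => // k'; apply: class_CN => //; exact: smooth_sl_w.
Qed.

(** [Phi] with [f_N Delta y_N] replaced by the quantity that the recursion
propagates.  Unlike [Phi], this matrix is polynomial in the coefficients of the
problem everywhere, because it does not divide by [1 / f_N]. *)
Definition transfer_mx (om : sl_coef R N) : 'M[{poly R[i]}]_2 :=
  mx22 (sl_ivp om 1 0 N).1 (sl_ivp om 0 1 N).1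
       (sl_ivp om 1 0 N).2 (sl_ivp om 0 1 N).2.

Lemma Phi_transfer_mx om : Omega om -> Phi om = transfer_mx om.
Proof.
move=> om_Omega; have omO : om \in @Omega R N by exact: mem_set.
by rewrite /Phi /phi /psi !sl_ivp_delta.
Qed.

Lemma smooth_mx22 (V : normedModType R) (U : set V)
    (a b c d : V -> {poly R[i]}) :
  smooth_poly U a -> smooth_poly U b -> smooth_poly U c -> smooth_poly U d ->
  smooth_mx U (fun s => mx22 (a s) (b s) (c s) (d s)).
Proof.
move=> Ca Cb Cc Cd i j; under eq_fun do rewrite mxE.
by case: i => -[|[|//]] ?; case: j => -[|[|//]] ?.
Qed.

Lemma smoothC_mx22 (V : normedModType R) (U : set V) (a b c d : V -> R[i]) i j :
  smoothC U a -> smoothC U b -> smoothC U c -> smoothC U d ->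
  smoothC U (fun s => mx22 (a s) (b s) (c s) (d s) i j).
Proof.
move=> Ca Cb Cc Cd; under eq_fun do rewrite mxE.
by case: i => -[|[|//]] ?; case: j => -[|[|//]] ?.
Qed.

Lemma smoothC_chart_mx c i j : smoothC W (fun s : param => chart_mx c s.2 i j).
Proof.
have Ca : smoothC W (fun s : param => s.2.1.1%:C).
  apply: smoothC_real => //; apply: smooth_linear => //.
  apply: (comp_snd_continuous (f := fun v => v.1.1)).
  by apply: (comp_fst_continuous (f := fst)) => x; exact: cvg_fst.
have Cb : smoothC W (fun s : param => s.2.1.2%:C).
  apply: smoothC_real => //; apply: smooth_linear => //.
  apply: (comp_snd_continuous (f := fun v => v.1.2)).
  by apply: (comp_fst_continuous (f := snd)) => x; exact: cvg_snd.
have Cz : smoothC W (fun s : param => s.2.2.1 +i* s.2.2.2).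
  split; apply: smooth_linear => //=.
    apply: (comp_snd_continuous (f := fun v => v.2.1)).
    by apply: (comp_snd_continuous (f := fst)) => x; exact: cvg_fst.
  apply: (comp_snd_continuous (f := fun v => v.2.2)).
  by apply: (comp_snd_continuous (f := snd)) => x; exact: cvg_snd.
have Cz' := smoothC_conj oW Cz.
have C0 := smoothC_cst oW 0; have C1 := smoothC_cst oW 1.
have CN1 := smoothC_cst oW (-1).
by case: c; case: (split_ordP j) => k ->;
  under eq_fun do rewrite ?row_mxEl ?row_mxEr;
  apply: smoothC_mx22.
Qed.

Lemma smooth_poly_Gam c : W `<=` [set s | Omega s.1] ->
  exists2 p : param -> {poly R[i]}, smooth_poly W p &
    forall s, W s -> Gam s.1 (chart_mx c s.2) = p s.
Proof.
move=> WO; exists (fun s : param => \det (map_mx polyC (lsubmx (chart_mx c s.2)) +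
    map_mx polyC (rsubmx (chart_mx c s.2)) *m transfer_mx s.1)).
  apply: smooth_det => //; apply: smooth_mxD => //.
    apply: smooth_mx_polyC => // i j; under eq_fun do rewrite mxE.
    exact: smoothC_chart_mx.
  apply: smooth_mxM => //.
    apply: smooth_mx_polyC => // i j; under eq_fun do rewrite mxE.
    exact: smoothC_chart_mx.
  by apply: smooth_mx22; apply smooth_poly_sl_ivp.
by move=> s /WO Os; rewrite /Gam Phi_transfer_mx.
Qed.

End CharacteristicPolynomial.

(** * Continuity of the charts *)

Section ChartContinuity.
Variable R : realType.

Lemma real_complex_continuous : continuous (fun x : R => x%:C : R[i]^o).
Proof.
move=> x; apply/cvgrPdist_lt => e e0.
have eE : e = (complex.Re e)%:C by rewrite [LHS]complexE (ger0_Im (ltW e0)) mulr0 addr0.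
have re0 : 0 < complex.Re e by rewrite -ltcR -eE.
near=> y.
rewrite -rmorphB normc_def /= expr0n /= addr0 sqrtr_sqr eE ltcR.
near: y.
by have /cvgrPdist_lt := (@cvg_id _ (nbhs x)); apply.
Unshelve. all: by end_near. Qed.

Lemma complex_continuous (T : topologicalType) (f : T -> R[i]) :
  continuous (fun x => complex.Re (f x)) -> continuous (fun x => complex.Im (f x)) ->
  continuous f.
Proof.
move=> cr ci.
have -> : f = (fun x => (complex.Re (f x))%:C) + (fun x => 'i * (complex.Im (f x))%:C).
  apply/funext => x; exact: complexE.
move=> x; apply: (@cvgD _ R[i]^o).
  by apply: (continuous_comp (cr x)); exact: real_complex_continuous.
apply: (@cvgM R[i]); first exact: cvg_cst.
by apply: (continuous_comp (ci x)); exact: real_complex_continuous.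
Qed.

Lemma mx_continuous (S T : topologicalType) m n (A : S -> 'M[T]_(m, n)) :
  (forall i j, continuous (fun x => A x i j)) -> continuous A.
Proof.
move=> cA x U [P nP PU]; apply: filterS (PU) _ => /=.
by apply: filter_forall => i; apply: filter_forall => j; exact/cA/nP.
Qed.

Lemma chart_continuous N c :
  continuous (fun s : sl_coef R N * chart_coord R => chart c s.2).
Proof.
pose M (s : sl_coef R N * chart_coord R) : bc_mx R :=
  exist _ (chart_mx c s.2) (mem_set (chart_mx_rank c s.2)).
have cM : continuous M.
  apply: continuous_comp_initial.
  suff cmx : continuous (fun s : sl_coef R N * chart_coord R => chart_mx c s.2).
    exact: cmx.
  apply: mx_continuous => i j.
  have oT : open [set: sl_coef R N * chart_coord R] by exact: openT.
  have [re im] := smoothC_chart_mx oT c i j.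
  apply: complex_continuous => x.
    exact: (class_C_continuous oT (re 0)).
  exact: (class_C_continuous oT (im 0)).
by move=> s; apply: (continuous_comp (cM s)); exact: pi_continuous.
Qed.

End ChartContinuity.

(** * Smoothness of simple eigenvalue branches *)

Theorem theorem4p2 (R : realType) (N : nat) (N_ge2 : (2 <= N)%N)
    (om : sl_coef R N) (X : bc R) (lam : R)
    (om_Omega : Omega om) (X_selfadjoint : selfadjoint_bc X)
    (lam_simple : simple_eigenvalue om X lam%:C)
    (U : set (sl_coef R N * bc R)) (L : sl_coef R N * bc R -> R)
    (L_branch : simple_eigenvalue_branch om X lam U L) :
  smooth_on_problems U L.
Proof.
have [[U_problems _] _ L_cont _ L_simple] := L_branch.
move=> c.
pose in_chart (s : sl_coef R N * chart_coord R) := (s.1, chart c s.2).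
set W := interior _.
have WU s : W s -> U (in_chart s) by exact: interior_subset.
have oW : open W by exact: open_interior.
have WO : W `<=` [set s | Omega s.1] by move=> s /WU /U_problems [].
have [p Cp GamE] := smooth_poly_Gam oW c WO.
have L_root s : W s ->
    root (p s) (L (in_chart s))%:C /\ (p s)^`().[(L (in_chart s))%:C] != 0.
  move=> Ws; apply: mup1_root; rewrite -GamE//.
  have := L_simple _ (WU s Ws); rewrite /simple_eigenvalue /=.
  have [T uT ->] := bc_repr_pi (exist _ (chart_mx c s.2) (mem_set (chart_mx_rank c s.2))).
  by move=> /(simple_eigenvalue_mxMl _ _ _ uT)[].
apply: (smooth_complex_root oW Cp).
- rewrite continuous_open_subspace// => s /set_mem Ws.
  have cs : in_chart @ nbhs s --> in_chart s.
    have c2 := @chart_continuous R N c s.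
    exact: (cvg_pair (@cvg_fst _ _ (nbhs s.1) (nbhs s.2) _) c2).
  move/subspace_continuousP : L_cont => /(_ _ (WU s Ws)) LU P /LU.
  move=> /= /cs; apply: filterS2 (near_open oW Ws) => t Wt.
  by apply; exact: WU.
- by move=> s /L_root[].
- by move=> s /L_root[].
Qed.
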